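(* Consider the reversed Zeckendorf game started from the position consisting of $a$ chips of value $1 = F_1$, $b$ chips of value $2 = F_2$ and $c$ chips of value $3 = F_3$ (and no other chips), where $a,b,c \geq 0$ are integers, with Player 1 moving first. Then: (1) if $a,b,c$ are all even, Player 2 has a forced win; (2) if $a,b,c$ are all odd, Player 1 has a forced win; (3) if $a$ even, $b$ odd, $c$ even, Player 1 has a forced win; (4) if $a$ odd, $b$ even, $c$ odd, Player 1 has a forced win; (5) if $a$ odd, $b$ even, $c$ even and $a > c$, Player 2 has a forced win; (6) if $a$ odd, $b$ even, $c$ even and $a < c$, Player 1 has a forced win; (7) if $a$ even, $b$ even, $c$ odd and $a > c$, Player 1 has a forced win; (8) if $a$ even, $b$ even, $c$ odd and $a < c$, Player 2 has a forced win; (9) if $a$ even, $b$ odd, $c$ odd, Player 1 has a forced win; (10) if $a$ odd, $b$ odd, $c$ even, Player 1 has a forced win.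
   Context: Fibonacci numbers are indexed $F_1=1$, $F_2=2$, $F_{k+1}=F_k+F_{k-1}$. A game state is a multiset of Fibonacci numbers (''chips''); the number of chips equal to $F_k$ is the height $h_k$ of bin $k$. In the reversed Zeckendorf game, two players alternate moves from a given starting state; the legal moves are: (Split) for $k \geq 3$, if $h_k \geq 1$, replace one chip $F_k$ by one chip $F_{k-1}$ and one chip $F_{k-2}$; and if $h_2 \geq 1$, replace one chip $F_2$ by two chips $F_1$. (Combine) for $k > 2$, if $h_{k-2}\ge1$ and $h_{k+1} \geq 1$, replace one chip $F_{k-2}$ and one chip $F_{k+1}$ by two chips $F_k$; and if $h_1 \geq 1$ and $h_3 \geq 1$, replace one chip $F_1$ and one chip $F_3$ by two chips $F_2$. A player who cannot move loses. *)

(* Defs.v *)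
From mathcomp Require Export all_boot.
From mathcomp Require Export finmap multiset.

Set Implicit Arguments.
Unset Strict Implicit.
Unset Printing Implicit Defensive.

Local Open Scope mset_scope.
Local Open Scope nat_scope.

(* F_1 = 1, F_2 = 2. Index 0 is not a bin and never occurs in a move; the
   value 1 there only makes the recurrence produce F_2 = 2. *)
Fixpoint F (k : nat) : nat :=
  match k with
  | 0 => 1
  | 1 => 1
  | (k'.+1 as k1).+1 => F k1 + F k'
  end.

(* The chips of a position, counted with multiplicity by their values. *)
Definition position : Type := {mset nat}.

Definition height (s : position) (k : nat) : nat := s (F k).

Inductive move (s : position) : position -> Prop :=
| Split k : 3 <= k -> 1 <= height s k ->
    move s (s `\` [mset F k] `+` [mset F (k - 1); F (k - 2)])
| Split2 : 1 <= height s 2 ->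
    move s (s `\` [mset F 2] `+` [mset F 1; F 1])
| Combine k : 2 < k -> 1 <= height s (k - 2) -> 1 <= height s (k + 1) ->
    move s (s `\` [mset F (k - 2); F (k + 1)] `+` [mset F k; F k])
| Combine2 : 1 <= height s 1 -> 1 <= height s 3 ->
    move s (s `\` [mset F 1; F 3] `+` [mset F 2; F 2]).

Inductive player : Type := Player1 | Player2.

Definition opponent (p : player) : player :=
  match p with Player1 => Player2 | Player2 => Player1 end.

(* [forced_win p q s]: p can force a win from s when q is to move. A player
   who cannot move loses: [ForcedWin_own] needs a move, and
   [ForcedWin_opponent] holds when there is none. Being inductive, the win
   comes after finitely many moves. *)
Inductive forced_win (p : player) : player -> position -> Prop :=
| ForcedWin_own s s' :
    move s s' -> forced_win p (opponent p) s' -> forced_win p p s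
| ForcedWin_opponent s :
    (forall s', move s s' -> forced_win p p s') ->
    forced_win p (opponent p) s.

Definition start (a b c : nat) : position :=
  msetn a (F 1) `+` msetn b (F 2) `+` msetn c (F 3).

(* Player 1 moves first. *)
Definition has_forced_win (p : player) (s : position) : Prop :=
  forced_win p Player1 s.

(* Main.v *)
Require Import Defs.
From mathcomp Require Import zify.

(** Write (a, b, c) for the position.  Play never leaves bins 1, 2 and 3, so the
    legal moves are (a+1, b+1, c-1), (a+2, b-1, c) and (a-1, b+2, c-1), all of
    which decrease b + 3c.  The player to move loses exactly when b is even and
    either a and c are both even, or a is odd, c is even and c < a, or a is even,
    c is odd and a < c: no move joins two such positions, and from every other
    position some move reaches one of them. *)

Local Open Scope mset_scope.
Local Open Scope nat_scope.

(** Heights are read off by chip value, so the bins beyond the third are seen to be empty once their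
    values differ from 1, 2 and 3. *)
Lemma F_ge4 k : 3 < k -> 3 < F k.
Proof.
have F_gt0 m : (0 < F m) && (0 < F m.+1).
  by elim: m => // m /andP[F0 F1]; rewrite F1 /= addn_gt0 F1.
case: k => [|[|[|[|k]]]] // _; elim: k => // k IHk.
by rewrite -[F _]/(F k.+4 + F k.+3); apply: leq_trans (leq_addr _ _).
Qed.

Lemma startE a b c x : start a b c x =
  (if x == 1 then a else 0) + (if x == 2 then b else 0) +
  (if x == 3 then c else 0).
Proof. by rewrite /start !msetE2 !msetnE. Qed.

Lemma start_height_gt3 a b c k : 3 < k -> height (start a b c) k = 0.
Proof. by move/F_ge4; rewrite /height startE; case: (F k) => [|[|[|[|]]]]. Qed.

Lemma start_split3 a b c :
  start a b c.+1 `\` [mset F 3] `+` [mset F 2; F 1] = start a.+1 b.+1 c.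
Proof.
apply/msetP => x; rewrite !(msetE2, startE, msetnE) /=.
by case: x => [|[|[|[|x]]]] //=; lia.
Qed.

Lemma start_split2 a b c :
  start a b.+1 c `\` [mset F 2] `+` [mset F 1; F 1] = start a.+2 b c.
Proof.
apply/msetP => x; rewrite !(msetE2, startE, msetnE) /=.
by case: x => [|[|[|[|x]]]] //=; lia.
Qed.

Lemma start_combine2 a b c :
  start a.+1 b c.+1 `\` [mset F 1; F 3] `+` [mset F 2; F 2] = start a b.+2 c.
Proof.
apply/msetP => x; rewrite !(msetE2, startE, msetnE) /=.
by case: x => [|[|[|[|x]]]] //=; lia.
Qed.

Lemma move_start_split3 a b c : move (start a b c.+1) (start a.+1 b.+1 c).
Proof. by rewrite -start_split3; apply: (@Split _ 3); rewrite // /height startE. Qed.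

Lemma move_start_split2 a b c : move (start a b.+1 c) (start a.+2 b c).
Proof. by rewrite -start_split2; apply: Split2; rewrite /height startE. Qed.

Lemma move_start_combine2 a b c : move (start a.+1 b c.+1) (start a b.+2 c).
Proof. by rewrite -start_combine2; apply: Combine2; rewrite /height startE. Qed.

(** A split with [k > 3] needs a chip in bin [k], and a combine with [k > 2] one in bin [k + 1];
    these bins are empty. *)
Lemma move_startP a b c s : move (start a b c) s ->
  [\/ exists2 c', c = c'.+1 & s = start a.+1 b.+1 c',
      exists2 b', b = b'.+1 & s = start a.+2 b' c
    | exists a' c', [/\ a = a'.+1, c = c'.+1 & s = start a' b.+2 c']].
Proof.
case=> [k k_ge3 | | k k_gt2 _ | ].
- have [/start_height_gt3-> // | k_le3] := ltnP 3 k.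
  have -> : k = 3 by lia.
  rewrite /height startE; case: c => // c _.
  by constructor 1; exists c; rewrite ?start_split3.
- rewrite /height startE; case: b => // b _.
  by constructor 2; exists b; rewrite ?start_split2.
- by rewrite start_height_gt3 //; lia.
- rewrite /height !startE; case: a => // a _; case: c => // c _.
  by constructor 3; exists a, c; rewrite start_combine2.
Qed.

Definition losing a b c : bool :=
  [&& ~~ odd b, odd a ==> ~~ odd c && (c < a) & odd c ==> ~~ odd a && (a < c)].

(** Either split changes the parity of [b], which is even in every losing position. *)
Lemma losing_split3 a b c : losing a b c.+1 -> ~~ losing a.+1 b.+1 c.
Proof. by rewrite /losing /=; case: (odd b). Qed.

Lemma losing_split2 a b c : losing a b.+1 c -> ~~ losing a.+2 b c.
Proof. by rewrite /losing /=; case: (odd b). Qed.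

(** Both parities flip while the order of [a] and [c] is kept, so two even counts become odd, and in
    the mixed cases the required inequality is reversed. *)
Lemma losing_combine2 a b c : losing a.+1 b c.+1 -> ~~ losing a b.+2 c.
Proof. by rewrite /losing /=; case: (odd a) (odd c) => [] [] /=; lia. Qed.

Lemma not_losing_move a b c : ~~ losing a b c ->
  [\/ exists2 c', c = c'.+1 & losing a.+1 b.+1 c',
      exists2 b', b = b'.+1 & losing a.+2 b' c
    | exists a' c', [/\ a = a'.+1, c = c'.+1 & losing a' b.+2 c']].
Proof.
have [b_odd _ | b_even] := boolP (odd b); last first.
  (* With [b] even, [a = 0] or [c = 0] would make the position losing, so the combine move is
     available. *)
  rewrite /losing; case: a c => [|a] [|c] /= notL; try lia.
  by constructor 3; exists a, c; split=> //; lia.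
case: b b_odd => // b /= b_even.
have [L2 | ] := boolP (losing a.+2 b c); first by constructor 2; exists b.
(* [c = 0] would make the position after splitting a 2 losing. Otherwise splitting a 3 differs from
   that move by lowering [a] and [c] by one, as a combine does. *)
case: c => [|c]; rewrite /losing /= => notL2; first lia.
by constructor 1; exists c => //; lia.
Qed.

(** Both halves are proved in one induction on [b + 3 * c], as each uses the other after one
    move. *)
Lemma forced_win_start p a b c :
  (losing a b c -> forced_win p (opponent p) (start a b c)) /\
  (~~ losing a b c -> forced_win p p (start a b c)).
Proof.
have [n] := ubnP (b + 3 * c); elim: n => // n IHn in a b c *; rewrite ltnS => le_n.
split=> [L | /not_losing_move[] [x]].
- apply: ForcedWin_opponent => s /move_startP[] [x].
  + move=> cE ->; rewrite {}cE in L le_n; apply: (proj2 (IHn _ _ _ _)); first lia.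
    exact: losing_split3.
  + move=> bE ->; rewrite {}bE in L le_n; apply: (proj2 (IHn _ _ _ _)); first lia.
    exact: losing_split2.
  + case=> y [aE cE ->]; rewrite {}aE {}cE in L le_n.
    apply: (proj2 (IHn _ _ _ _)); first lia.
    exact: losing_combine2.
- move=> cE L; rewrite {}cE in le_n *; apply: ForcedWin_own (move_start_split3 _ _ _) _.
  by apply: (proj1 (IHn _ _ _ _)) L; lia.
- move=> bE L; rewrite {}bE in le_n *; apply: ForcedWin_own (move_start_split2 _ _ _) _.
  by apply: (proj1 (IHn _ _ _ _)) L; lia.
- case=> y [aE cE L]; rewrite {}aE {}cE in le_n *.
  apply: ForcedWin_own (move_start_combine2 _ _ _) _.
  by apply: (proj1 (IHn _ _ _ _)) L; lia.
Qed.

Theorem theorem1p6 (a b c : nat) :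
  (~~ odd a -> ~~ odd b -> ~~ odd c -> has_forced_win Player2 (start a b c)) /\
  (odd a -> odd b -> odd c -> has_forced_win Player1 (start a b c)) /\
  (~~ odd a -> odd b -> ~~ odd c -> has_forced_win Player1 (start a b c)) /\
  (odd a -> ~~ odd b -> odd c -> has_forced_win Player1 (start a b c)) /\
  (odd a -> ~~ odd b -> ~~ odd c -> c < a ->
    has_forced_win Player2 (start a b c)) /\
  (odd a -> ~~ odd b -> ~~ odd c -> a < c ->
    has_forced_win Player1 (start a b c)) /\
  (~~ odd a -> ~~ odd b -> odd c -> c < a ->
    has_forced_win Player1 (start a b c)) /\
  (~~ odd a -> ~~ odd b -> odd c -> a < c ->
    has_forced_win Player2 (start a b c)) /\
  (~~ odd a -> odd b -> odd c -> has_forced_win Player1 (start a b c)) /\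
  (odd a -> odd b -> ~~ odd c -> has_forced_win Player1 (start a b c)).
Proof.
have win1 : ~~ losing a b c -> has_forced_win Player1 (start a b c).
  exact: (proj2 (forced_win_start Player1 a b c)).
(* [opponent Player2] computes to [Player1], the player to move. *)
have win2 : losing a b c -> has_forced_win Player2 (start a b c).
  exact: (proj1 (forced_win_start Player2 a b c)).
do !split=> *; (apply: win1 || apply: win2); rewrite /losing; lia.
Qed.
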